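(* Let $X$ be a nonempty compact Hausdorff space and let $E$ be a commutative Banach algebra with unit. Then $C(X,E)$ has bounded relative units if and only if $E$ has bounded relative units.
   Context: Banach algebras are over $\mathbb{C}$. $C(X,E)$ is the algebra of all continuous maps $X\to E$ with pointwise operations and the norm $\|f\|_X=\sup_{x\in X}\|f(x)\|$; it is a commutative Banach algebra with unit. Let $A$ be a commutative Banach algebra with unit (not assumed semisimple). $M(A)$ is the set of nonzero multiplicative linear functionals $A\to\mathbb{C}$ with the relative weak-star topology from $A^*$, and $\hat a(\phi)=\phi(a)$ for $a\in A$, $\phi\in M(A)$. For $\phi\in M(A)$, $J_\phi=\{a\in A:\phi\notin\mathrm{supp}(a)\}$, where $\mathrm{supp}(a)$ is the closure in $M(A)$ of $\{\chi\in M(A):\hat a(\chi)\ne0\}$. $A$ has bounded relative units if for every $\phi\in M(A)$ there exists $m_\phi>0$ such that for each compact subset $K$ of $M(A)\setminus\{\phi\}$ there exists $a\in J_\phi$ with $\hat a(K)\subset\{1\}$ and $\|a\|\le m_\phi$. *)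

(* Defs.v *)
From HB Require Import structures.
From mathcomp Require Import all_boot all_order all_algebra.
From mathcomp Require Import all_classical all_reals all_analysis.
From mathcomp.real_closed Require Import complex.
From mathcomp Require Import ring.

Set Implicit Arguments.
Unset Strict Implicit.
Unset Printing Implicit Defensive.

Import Order.TTheory GRing.Theory Num.Theory.
Import numFieldNormedType.Exports.

Local Open Scope classical_set_scope.
Local Open Scope complex_scope.
Local Open Scope ring_scope.

(* Commutative unital Banach algebras. The zero algebra is allowed, and the norm
   of the unit is not assumed to be 1. The multiplication is part of the mixin
   because a structure inheriting from both the ring and the normed module
   hierarchies of the library is rejected by HB (missing join with
   Num.NumDomain); the ring notations are recovered by the instance below. *)
HB.mixin Record isComBanachAlgebra (K : numFieldType) A
    & CompleteNormedModule K A := {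
  banach_one : A ;
  banach_mul : A -> A -> A ;
  banach_mulA : associative banach_mul ;
  banach_mulC : commutative banach_mul ;
  banach_mul1 : left_id banach_one banach_mul ;
  banach_mulDl : left_distributive banach_mul +%R ;
  banach_scaleAl : forall (k : K) (a b : A),
    k *: banach_mul a b = banach_mul (k *: a) b ;
  banach_normM : forall a b : A, `|banach_mul a b| <= `|a| * `|b|
}.

#[short(type="comBanachAlgType")]
HB.structure Definition ComBanachAlgebra (K : numFieldType) :=
  {A of CompleteNormedModule K A & isComBanachAlgebra K A}.

#[non_forgetful_inheritance]
HB.instance Definition _ (K : numFieldType) (A : comBanachAlgType K) :=
  GRing.Zmodule_isComPzRing.Build A
    (@banach_mulA K A) (@banach_mulC K A) (@banach_mul1 K A)
    (@banach_mulDl K A).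

Section bounded_relative_units.
Variables (R : realType) (A : comBanachAlgType R[i]).

(* Multiplicative linear functionals are automatically continuous on a Banach
   algebra. The weak-star topology is the topology of pointwise convergence on
   A, so M(A) is a set in {ptws A -> C}, and as a type it carries the subspace
   topology. R[i]^o is C as a normed space over itself. *)
Definition nonzero_characters : set {ptws A -> R[i]^o} :=
  [set phi : A -> R[i]^o | [/\ scalar phi, {morph phi : a b / a * b} &
                 exists a, phi a != 0]].

Definition character_space : topologicalType := set_type nonzero_characters.

Definition gelfand (a : A) (phi : character_space) : R[i] := set_val phi a.

Definition supp (a : A) : set character_space :=
  closure [set chi | gelfand a chi != 0].

Definition ideal_J (phi : character_space) : set A := [set a | ~ supp a phi].

Definition bounded_relative_units :=
  forall phi : character_space, exists2 m : R, 0 < m &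
    forall K : set character_space, compact K -> K `<=` ~` [set phi] ->
      exists a : A, [/\ ideal_J phi a,
                        gelfand a @` K `<=` [set 1] &
                        `|a| <= m%:C].

End bounded_relative_units.

Arguments nonzero_characters {R} A _ : rename.

Section banach_theory.
Variables (R : realType) (E : comBanachAlgType R[i]).
Implicit Types a b v : E.

Lemma banach_mul_continuous : continuous (fun z : E * E => z.1 * z.2).
Proof.
move=> [a b]; apply/cvgrPdist_lt => /= e e0.
have k0 : 0 < `|a| + `|b| + 1 by rewrite ltr_wpDl// addr_ge0.
near=> z.
have -> : a * b - z.1 * z.2 = (a - z.1) * z.2 + a * (b - z.2).
  by rewrite mulrBl mulrBr [RHS]addrC [RHS]addrA subrK.
rewrite (le_lt_trans (ler_normD _ _))//.
rewrite (le_lt_trans (lerD (banach_normM _ _) (banach_normM _ _)))//.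
have z2 : `|z.2| <= `|b| + 1.
  rewrite -lerBlDl (le_trans (lerB_dist _ _))// distrC ltW//.
  by near: z; apply: cvgr_dist_lt => //; exact: cvg_snd.
have za : `|a - z.1| < e / (`|a| + `|b| + 1).
  near: z; apply: cvgr_dist_lt; [exact: cvg_fst|exact: divr_gt0].
have zb : `|b - z.2| < e / (`|a| + `|b| + 1).
  near: z; apply: cvgr_dist_lt; [exact: cvg_snd|exact: divr_gt0].
set d := e / _ in za zb.
have d0 : 0 < d by exact: divr_gt0.
have -> : e = d * (`|b| + 1) + `|a| * d.
  by rewrite [`|a| * d]mulrC -mulrDr addrC addrA divfK// gt_eqF.
rewrite ltr_leD//; last by rewrite ler_wpM2l// ltW.
by rewrite (le_lt_trans (ler_wpM2l _ z2))// ltr_pM2r// ltr_wpDl.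
Unshelve. all: by end_near. Qed.

Definition Re_norm (v : E) : R := complex.Re `|v|.

Lemma Re_normE v : (Re_norm v)%:C = `|v|.
Proof. by rewrite /Re_norm RRe_real// ger0_real. Qed.

Lemma Re_norm_continuous : continuous Re_norm.
Proof.
move=> v; apply/cvgrPdist_lt => e e0.
have e0' : 0 < e%:C by rewrite ltcR.
near=> w.
rewrite -ltcR.
have -> : (`|Re_norm v - Re_norm w|)%:C = `| `|v| - `|w| |.
  by rewrite -!Re_normE -rmorphB/= normc_def/= expr0n addr0 sqrtr_sqr.
apply: le_lt_trans (ler_dist_dist _ _) _.
by near: w; apply: cvgr_dist_lt.
Unshelve. all: by end_near. Qed.

End banach_theory.

(* C(X, E). The compactness proof is a parameter of the type because it is what
   makes the sup norm finite. *)
Definition cfun (R : realType) (X : topologicalType) (cX : compact [set: X])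
  (E : comBanachAlgType R[i]) : Type := continuousType X E.

Section cfun_algebra.
Variables (R : realType) (X : topologicalType) (cX : compact [set: X]).
Variable E : comBanachAlgType R[i].
Local Notation C := (cfun cX E).

HB.instance Definition _ := gen_eqMixin C.
HB.instance Definition _ := gen_choiceMixin C.

Implicit Types f g h : C.

Lemma cfunP f g : f =1 g -> f = g.
Proof. by move=> fg; apply/continuousEP. Qed.

Lemma cfun_continuous f : continuous f.
Proof. exact: cts_fun. Qed.

Definition mkcfun (f : X -> E) (cf : continuous f) : C :=
  (mkcts cf : continuousType X E).

Lemma cst_continuous_subproof (v : E) : continuous (fun _ : X => v).
Proof. by move=> x; exact: cvg_cst. Qed.

Lemma opp_continuous_subproof f : continuous (fun x => - f x).
Proof. by move=> x; apply: cvgN; exact: cfun_continuous. Qed.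

Lemma add_continuous_subproof f g : continuous (fun x => f x + g x).
Proof. by move=> x; apply: cvgD; exact: cfun_continuous. Qed.

Lemma scale_continuous_subproof (k : R[i]) f : continuous (fun x => k *: f x).
Proof. by move=> x; apply: cvgZl_tmp; exact: cfun_continuous. Qed.

Lemma mul_continuous_subproof f g : continuous (fun x => f x * g x).
Proof.
move=> x.
apply: (@continuous2_cvg X E E E (nbhs x) _ f g (fun a b => a * b) (f x) (g x)).
- exact: (@banach_mul_continuous _ _ (f x, g x)).
- exact: cfun_continuous.
- exact: cfun_continuous.
Qed.

Definition cfun_cst (v : E) : C := mkcfun (@cst_continuous_subproof v).
Definition cfun_opp f : C := mkcfun (@opp_continuous_subproof f).
Definition cfun_add f g : C := mkcfun (@add_continuous_subproof f g).
Definition cfun_scale k f : C := mkcfun (@scale_continuous_subproof k f).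
Definition cfun_mul f g : C := mkcfun (@mul_continuous_subproof f g).

Lemma cfun_addA : associative cfun_add.
Proof. by move=> f g h; apply: cfunP => x; exact: addrA. Qed.
Lemma cfun_addC : commutative cfun_add.
Proof. by move=> f g; apply: cfunP => x; exact: addrC. Qed.
Lemma cfun_add0 : left_id (cfun_cst 0) cfun_add.
Proof. by move=> f; apply: cfunP => x; exact: add0r. Qed.
Lemma cfun_addN : left_inverse (cfun_cst 0) cfun_opp cfun_add.
Proof. by move=> f; apply: cfunP => x; exact: addNr. Qed.

HB.instance Definition _ :=
  GRing.isZmodule.Build C cfun_addA cfun_addC cfun_add0 cfun_addN.

Lemma cfun_scaleA a b f : cfun_scale a (cfun_scale b f) = cfun_scale (a * b) f.
Proof. by apply: cfunP => x; exact: scalerA. Qed.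
Lemma cfun_scale1 : left_id 1 cfun_scale.
Proof. by move=> f; apply: cfunP => x; exact: scale1r. Qed.
Lemma cfun_scaleDr : right_distributive cfun_scale +%R.
Proof. by move=> k f g; apply: cfunP => x; exact: scalerDr. Qed.
Lemma cfun_scaleDl f : {morph cfun_scale^~ f : a b / a + b}.
Proof. by move=> a b; apply: cfunP => x; exact: scalerDl. Qed.

HB.instance Definition _ := GRing.Zmodule_isLmodule.Build R[i] C
  cfun_scaleA cfun_scale1 cfun_scaleDr cfun_scaleDl.

Definition cfun_norm f : R[i] := (sup [set complex.Re `|f x| | x in [set: X]])%:C.

Lemma cfun_norm_has_ubound f :
  has_ubound [set complex.Re `|f x| | x in [set: X]].
Proof.
have : compact [set complex.Re `|f x| | x in [set: X]].
  apply: continuous_compact cX; apply: continuous_subspaceT => x.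
  apply: (@continuous_comp _ _ _ f (@Re_norm R E)).
    exact: cfun_continuous.
  exact: Re_norm_continuous.
move=> /compact_bounded[M [_ /(_ (M + 1))]].
rewrite ltrDl ltr01 => /(_ isT) bM; exists (M + 1) => _ [x _ <-].
by rewrite (le_trans (ler_norm _))//; apply: bM; exists x.
Qed.

Lemma cfun_norm_ub f x : `|f x| <= cfun_norm f.
Proof.
rewrite -Re_normE lecR; apply: ub_le_sup; last by exists x.
exact: cfun_norm_has_ubound.
Qed.

Lemma cfun_norm_ge0 f : 0 <= cfun_norm f.
Proof.
rewrite /cfun_norm ler0c; have [[_ [x _ _]]|X0] :=
  pselect ([set complex.Re `|f x| | x in [set: X]] !=set0).
  apply: (@le_trans _ _ (complex.Re `|f x|)).
    by rewrite -[_ <= _](lecR 0) -/(Re_norm _) Re_normE normr_ge0.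
  by apply: ub_le_sup; [exact: cfun_norm_has_ubound|exists x].
by rewrite sup_out// => -[].
Qed.

Lemma cfun_norm_le f (e : R[i]) :
  0 <= e -> (forall x, `|f x| <= e) -> cfun_norm f <= e.
Proof.
move=> e0 fe; rewrite -(RRe_real (ger0_real e0)) /cfun_norm lecR.
have [Y0|X0] := pselect ([set complex.Re `|f x| | x in [set: X]] !=set0).
  apply: ge_sup => // _ [x _ <-].
  by rewrite -lecR -/(Re_norm _) Re_normE (RRe_real (ger0_real e0)).
rewrite sup_out; last by case.
by rewrite -ler0c (RRe_real (ger0_real e0)).
Qed.

Lemma cfun_normD f g : cfun_norm (f + g) <= cfun_norm f + cfun_norm g.
Proof.
apply: cfun_norm_le => [|x]; first by rewrite addr_ge0 ?cfun_norm_ge0.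
by rewrite (le_trans (ler_normD _ _))// lerD// cfun_norm_ub.
Qed.

Lemma cfun_normZ (k : R[i]) f : cfun_norm (k *: f) = `|k| * cfun_norm f.
Proof.
have le_normZ l g : cfun_norm (l *: g) <= `|l| * cfun_norm g.
  apply: cfun_norm_le => [|x]; first by rewrite mulr_ge0 ?cfun_norm_ge0.
  by rewrite normrZ ler_wpM2l// cfun_norm_ub.
apply/eqP; rewrite eq_le le_normZ/=.
have [->|k0] := eqVneq k 0; first by rewrite normr0 mul0r cfun_norm_ge0.
rewrite mulrC -ler_pdivlMr ?normr_gt0// mulrC -normfV.
by rewrite -{1}[f](scalerK k0) le_normZ.
Qed.

Lemma cfun_norm0_eq0 f : cfun_norm f = 0 -> f = 0.
Proof.
move=> f0; apply: cfunP => x; apply/eqP.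
by rewrite -normr_le0 -f0 cfun_norm_ub.
Qed.

HB.instance Definition _ := Lmodule_isNormed.Build R[i] C
  cfun_normD cfun_normZ cfun_norm0_eq0.

Lemma cfun_complete (F : set_system C) : ProperFilter F -> cauchy F -> cvg F.
Proof.
move=> FF /cauchy_ballP Fc.
have near_F (e : R[i]) : 0 < e ->
    \forall f & g \near F, forall x, `|(f : C) x - (g : C) x| <= e.
  move=> e0; apply: filterS (Fc e e0) => -[f g] /=.
  rewrite -ball_normE/= => fg x.
  by rewrite (le_trans (cfun_norm_ub (f - g) x))// ltW.
have cvg_x x : cvg ((fun f : C => f x : E) @ F).
  apply: cauchy_cvg; apply/cauchy_ballP => e e0.
  have := near_F (e / 2) (divr_gt0 e0 (ltr0Sn _ _)).
  rewrite !near_simpl => -[[P Q] /= [FP FQ] PQ].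
  exists ((fun f : C => f x) @` P, (fun f : C => f x) @` Q).
    by split; [apply: filterS FP => f Pf|apply: filterS FQ => f Pf]; exists f.
  move=> [_ _] /= [[f Pf <-] [g Qg <-]]; rewrite -ball_normE/=.
  apply: le_lt_trans (PQ (f, g) _ x) _ => //.
  by rewrite ltr_pdivrMr// ltr_pMr// ltr1n.
pose g x : E := lim ((fun f : C => f x : E) @ F).
have near_g (e : R[i]) : 0 < e ->
    \forall f \near F, forall x, `|g x - (f : C) x| <= e.
  move=> e0; have e20 : 0 < e / 2 by rewrite divr_gt0.
  near=> f => x; near F => h.
  have hf : forall y, `|h y - f y| <= e / 2.
    near: h; near: f.
    by apply: nearP_dep; apply: filterS (near_F _ e20) => -[? ?] /= + y;
      rewrite distrC; exact.
  rewrite (le_trans (ler_distD (h x) _ _))// [leRHS]splitr lerD//.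
  by rewrite ltW//; near: h; apply: cvgr_dist_lt => //; exact: cvg_x.
have cg : continuous g.
  move=> x; apply/cvgrPdist_lt => e e0.
  have e30 : 0 < e / 3 by rewrite divr_gt0.
  near F => f.
  have gf y : `|g y - f y| <= e / 3 by move: y; near: f; exact: near_g.
  near=> y.
  rewrite (le_lt_trans (ler_distD (f x) _ _))//.
  have -> : e = e / 3 + (e / 3 + e / 3) by field.
  rewrite ler_ltD// (le_lt_trans (ler_distD (f y) _ _))//.
  rewrite ltr_leD//; last by rewrite distrC.
  by near: y; apply: cvgr_dist_lt => //; exact: cfun_continuous.
apply/cvg_ex; exists (mkcfun cg); apply/cvgrPdist_le => e e0.
apply: filterS (near_g e e0) => f gf.
by apply: cfun_norm_le; [exact: ltW|exact: gf].
Unshelve. all: by end_near. Qed.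

HB.instance Definition _ := Uniform_isComplete.Build C cfun_complete.

Lemma cfun_mulA : associative cfun_mul.
Proof. by move=> f g h; apply: cfunP => x; exact: mulrA. Qed.
Lemma cfun_mulC : commutative cfun_mul.
Proof. by move=> f g; apply: cfunP => x; exact: mulrC. Qed.
Lemma cfun_mul1 : left_id (cfun_cst 1) cfun_mul.
Proof. by move=> f; apply: cfunP => x; exact: mul1r. Qed.
Lemma cfun_mulDl : left_distributive cfun_mul +%R.
Proof. by move=> f g h; apply: cfunP => x; exact: mulrDl. Qed.
Lemma cfun_scaleAl (k : R[i]) f g :
  k *: cfun_mul f g = cfun_mul (k *: f) g.
Proof. by apply: cfunP => x; exact: banach_scaleAl. Qed.
Lemma cfun_normM f g : `|cfun_mul f g| <= `|f| * `|g|.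
Proof.
apply: cfun_norm_le => [|x]; first by rewrite mulr_ge0 ?normr_ge0.
by rewrite (le_trans (banach_normM _ _))// ler_pM// cfun_norm_ub.
Qed.

HB.instance Definition _ := isComBanachAlgebra.Build R[i] C
  cfun_mulA cfun_mulC cfun_mul1 cfun_mulDl cfun_scaleAl cfun_normM.

#[non_forgetful_inheritance]
HB.instance Definition _ :=
  GRing.ComPzRing.copy C (C : comBanachAlgType R[i]).

End cfun_algebra.

(* Main.v *)
(* The characters of C(X, E) are the maps [f |-> phi (f x)] with [x] in [X] and
   [phi] in M(E). If C(X, E) has bounded relative units, evaluating them at a
   point gives relative units of E, with the same bounds. Conversely, a compact
   set missing [(x0, phi0)] misses a neighborhood [U x V]; if [a] is a relative
   unit of E at [phi0] for the part of its projection to M(E) outside [V], and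
   the function [s] is 1 near [x0] and 0 outside [U], then [(1 - s) 1 + s a] is a
   relative unit of C(X, E), of norm at most [|1| + |a|]. *)
Require Import Defs.
From mathcomp Require Import all_boot all_order all_algebra.
From mathcomp Require Import all_classical all_reals all_analysis.
From mathcomp.real_closed Require Import complex.
From mathcomp Require Import lra.

Set Implicit Arguments.
Unset Strict Implicit.
Unset Printing Implicit Defensive.

Import Order.TTheory GRing.Theory Num.Theory.
Import numFieldNormedType.Exports.
Local Open Scope classical_set_scope.
Local Open Scope complex_scope.
Local Open Scope ring_scope.

(** * Characters of a commutative Banach algebra and the topology on them *)

Section character.
Variables (R : realType) (A : comBanachAlgType R[i]).
Implicit Types (a b : A) (phi : character_space A).

(** The solution is the geometric series [b + b^2 + ...], obtained as the limit of the iterates of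
    [c |-> b + b * c] from 0. Starting at 0 keeps the unit, whose norm need not be 1, out of the
    estimates. *)
Lemma geometric_fixpoint b : `|b| < 1 -> exists c, c = b + b * c.
Proof.
move=> b1; pose f c := b + b * c; pose s n := iter n f 0.
have b10 : 0 < 1 - `|b| by rewrite subr_gt0.
have f_lip n x y : `|iter n f x - iter n f y| <= `|b| ^+ n * `|x - y|.
  elim: n => [|n IH]; first by rewrite expr0 mul1r.
  rewrite /= {1}/f {2}/f opprD addrACA subrr add0r -mulrBr.
  rewrite (le_trans (banach_normM _ _))// exprS -mulrA.
  by rewrite ler_wpM2l.
(* [C] is the sum of the powers [|b|^n] for [n >= 1]; being a fixed point of [r |-> |b| + |b| * r],
   it bounds every iterate by induction. *)
pose C := `|b| / (1 - `|b|).
have CE : C = `|b| + `|b| * C.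
  have h : C * (1 - `|b|) = `|b| by rewrite /C divfK// gt_eqF.
  by rewrite -[X in X + _]h mulrBr mulr1 [C * _]mulrC subrK.
have C0 : 0 <= C by rewrite divr_ge0// ltW.
have s_le n : `|s n| <= C.
  elim: n => [|n IH]; first by rewrite normr0.
  rewrite [s n.+1]/= /f (le_trans (ler_normD _ _))// CE lerD//.
  by rewrite (le_trans (banach_normM _ _))// ler_wpM2l.
have s_dist n k : (n <= k)%N -> `|s n - s k| <= `|b| ^+ n * C.
  move=> nk; rewrite -(subnKC nk) /s iterD.
  apply: (le_trans (f_lip _ _ _)); rewrite ler_wpM2l ?exprn_ge0// sub0r normrN.
  exact: s_le.
have cvgb (e : R[i]) : 0 < e -> exists n, `|b| ^+ n * C < e.
  move=> e0.
  pose r := complex.Re `|b|; pose c := complex.Re C; pose d := complex.Re e.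
  have rE : r%:C = `|b| by rewrite RRe_real// ger0_real.
  have cE : c%:C = C by rewrite RRe_real// ger0_real.
  have dE : d%:C = e by rewrite RRe_real// gtr0_real.
  have r1 : `|r| < 1.
    have r0 : 0 <= r by rewrite -lecR rE; exact: normr_ge0.
    by rewrite ger0_norm// -ltcR rE.
  have := cvg_geometric c r1 => /cvgrPdist_lt /(_ d).
  rewrite -ltcR dE => /(_ e0) [n _ /(_ n (leqnn n))] /= h.
  exists n; rewrite -rE -cE -dE -rmorphXn -rmorphM ltcR mulrC.
  by rewrite (le_lt_trans (ler_norm _))// -normrN -sub0r.
have cs : cvgn s.
  apply/cauchy_cvgP/cauchy_exP => e e0.
  have [n ne] := cvgb e e0; exists (s n), n => // k /= nk.
  by rewrite -ball_normE /=; apply: le_lt_trans ne; exact: s_dist.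
exists (limn s).
have h1 : (fun n => s n.+1) @ \oo --> limn s by rewrite cvg_shiftS.
apply: (cvg_unique _ h1) => //=.
apply: cvgD; first exact: cvg_cst.
apply: (@continuous2_cvg _ _ _ _ _ _ (fun=> b) s (fun a b => a * b)) => //.
  exact: (@banach_mul_continuous _ _ (b, limn s)).
exact: cvg_cst.
Qed.

Lemma gelfand_linear phi a b (k : R[i]) :
  gelfand (k *: a + b) phi = k * gelfand a phi + gelfand b phi.
Proof. by have [+ _ _] := set_valP phi; exact. Qed.

Lemma gelfandM phi a b : gelfand (a * b) phi = gelfand a phi * gelfand b phi.
Proof. by have [_ + _] := set_valP phi; exact. Qed.

Lemma gelfandD phi a b : gelfand (a + b) phi = gelfand a phi + gelfand b phi.
Proof. by rewrite -[a]scale1r gelfand_linear mul1r scale1r. Qed.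

Lemma gelfand0 phi : gelfand 0 phi = 0.
Proof. by apply: (@addrI _ (gelfand 0 phi)); rewrite -gelfandD !addr0. Qed.

Lemma gelfandZ phi (k : R[i]) a : gelfand (k *: a) phi = k * gelfand a phi.
Proof. by rewrite -[k *: a]addr0 gelfand_linear gelfand0 addr0. Qed.

Lemma gelfandB phi a b : gelfand (a - b) phi = gelfand a phi - gelfand b phi.
Proof. by rewrite -[- b]scaleN1r gelfandD gelfandZ mulN1r. Qed.

Lemma gelfand1 phi : gelfand 1 phi = 1.
Proof.
have [_ _ [a a0]] := set_valP phi.
by apply: (mulIf a0); rewrite -gelfandM !mul1r.
Qed.

(* If [|phi a| > |a|], then [b = a / phi a] has [|b| < 1] and [phi b = 1], and
   applying [phi] to [c = b + b * c] gives [0 = 1]. *)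
Lemma gelfand_le_norm phi a : `|gelfand a phi| <= `|a|.
Proof.
rewrite real_leNgt ?normr_real//; apply/negP => lt_a.
have phia0 : gelfand a phi != 0.
  by rewrite -normr_gt0 (le_lt_trans _ lt_a)// normr_ge0.
have [|c] := @geometric_fixpoint ((gelfand a phi)^-1 *: a).
  by rewrite normrZ normfV mulrC ltr_pdivrMr ?mul1r// normr_gt0.
move=> /(congr1 (fun c => gelfand c phi)).
rewrite gelfandD gelfandM gelfandZ mulVf// mul1r => /eqP.
by rewrite -subr_eq subrr eq_sym oner_eq0.
Qed.

Lemma character_inj phi psi :
  (forall a, gelfand a phi = gelfand a psi) -> phi = psi.
Proof. by move=> h; apply: val_inj; apply/funext => a; exact: h. Qed.

Lemma gelfand_continuous a :
  continuous (gelfand a : character_space A -> R[i]^o).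
Proof.
move=> phi.
apply: (@continuous_comp _ _ _ (set_val : character_space A -> {ptws A -> R[i]^o})
  (fun f => f a)); first exact: initial_continuous.
exact: (@proj_continuous A (fun=> R[i]^o) a).
Qed.

(** The subspace topology is initial for the inclusion, and the pointwise topology is the supremum
    of the topologies induced by the evaluations. *)
Lemma character_space_continuous (Y : topologicalType)
    (g : Y -> character_space A) :
  (forall a, continuous (gelfand a \o g : Y -> R[i]^o)) -> continuous g.
Proof.
move=> cg; apply: continuous_comp_initial => y; apply/cvg_sup => a.
apply: (@continuous_comp_initial _ _ _ (fun f : A -> R[i]^o => f a)).
exact: cg.
Qed.

Lemma character_space_hausdorff : hausdorff_space (character_space A).
Proof.
move=> phi psi cl; apply: character_inj => a.
apply: (@norm_hausdorff _ R[i]^o) => U V nU nV.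
have [z [Uz Vz]] := cl _ _ (gelfand_continuous nU) (gelfand_continuous nV).
by exists (gelfand a z).
Qed.

End character.

(** * Multiplication of [E]-valued functions by real functions *)

Section cfun_scale_real.
Variables (R : realType) (X : topologicalType) (cX : compact [set: X]).
Variable E : comBanachAlgType R[i].
Local Notation C := (cfun cX E : comBanachAlgType R[i]).
Implicit Types (u v : X -> R) (f g : C).

Lemma real_complex_continuous : continuous (fun r : R => r%:C : R[i]^o).
Proof.
move=> r; apply/cvgrPdist_lt => e e0; near=> s.
rewrite -rmorphB/= normc_def/= expr0n addr0 sqrtr_sqr.
rewrite -(RRe_real (gtr0_real e0)) ltcR; near: s.
by apply: cvgr_dist_lt => //; rewrite -ltcR (RRe_real (gtr0_real e0)).
Unshelve. all: by end_near. Qed.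

Lemma scale_real_continuous u f :
  continuous u -> continuous (fun x => (u x)%:C *: f x).
Proof.
move=> cu x; apply: (@cvgZ _ _ _ (nbhs x) _ (fun y => (u y)%:C)).
  exact: (continuous_comp (cu x) (@real_complex_continuous (u x))).
exact: cfun_continuous.
Qed.

Definition scale_real u (cu : continuous u) f : C :=
  mkcfun cX (scale_real_continuous (f := f) cu).

Lemma scale_real1M u (cu : continuous u) f :
  scale_real cu 1 * f = scale_real cu f.
Proof.
apply: cfunP => x.
by apply: etrans (esym (banach_scaleAl _ _ _)) _; congr (_ *: _); exact: mul1r.
Qed.

Lemma mul_scale_real1 u v (cu : continuous u) (cv : continuous v) :
  (forall x, u x * v x = u x) ->
  scale_real cu 1 * scale_real cv 1 = scale_real cu 1.
Proof.
move=> uv; rewrite scale_real1M; apply: cfunP => x.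
by apply: etrans (scalerA _ _ _) _; rewrite -rmorphM/= uv.
Qed.

End cfun_scale_real.

(** * Characters of [C(X, E)] *)

Section characters_of_cfun.
Variables (R : realType) (X : topologicalType) (cX : compact [set: X]).
Variable E : comBanachAlgType R[i].
Local Notation C := (cfun cX E : comBanachAlgType R[i]).
Implicit Types (u v : X -> R) (f g : C) (psi : character_space C).

Lemma Re_norm_cfun_continuous f : continuous (fun x => Re_norm (f x)).
Proof.
move=> x; apply: (@continuous_comp _ _ _ f (@Re_norm R E)).
  exact: cfun_continuous.
exact: Re_norm_continuous.
Qed.

(* If [w] equals 1 where [v] is nonzero and [|w f|] is smaller than
   [|gelfand f psi|], then [v w = v] and [gelfand v psi != 0] would give
   [gelfand w psi = 1], so that [w f] and [f] have the same value at [psi]. *)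
Lemma gelfand_bump psi f : gelfand f psi != 0 ->
  exists2 e : R, 0 < e &
    forall v (cv : continuous v), (forall x, e <= Re_norm (f x) -> v x = 0) ->
      gelfand (scale_real cv 1 : C) psi = 0.
Proof.
move=> f0.
pose d := complex.Re `|gelfand f psi|; pose e := d / 4.
have dE : d%:C = `|gelfand f psi| by rewrite RRe_real// ger0_real.
have d0 : 0 < d by rewrite -ltcR dE normr_gt0.
have e0 : 0 < e by rewrite divr_gt0.
exists e => // v cv v0.
(* The cutoff [w] is 1 where [|f| <= e] and 0 where [|f| >= 2 * e], so [|w f| <= 2 * e = d / 2 < d];
   this is why [e] is [d / 4]. *)
pose w x := Num.min 1 (Num.max 0 (2 - Re_norm (f x) / e)).
have cf := @Re_norm_cfun_continuous f.
have cw : continuous w.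
  have cB : continuous (fun x => 2 - Re_norm (f x) / e).
    by move=> x; apply: cvgB; [exact: cvg_cst|apply: cvgMr_tmp; exact: cf].
  exact: (min_fun_continuous (@cst_continuous X R 1)
           (max_fun_continuous (@cst_continuous X R 0) cB)).
have vw x : v x * w x = v x.
  have [/v0->|fe] := leP e (Re_norm (f x)); first by rewrite mul0r.
  rewrite /w (_ : Num.min _ _ = 1) ?mulr1//; apply/min_idPl.
  have : Re_norm (f x) / e <= 1 by rewrite ler_pdivrMr// mul1r ltW.
  by move=> fe1; rewrite le_max; apply/orP; right; lra.
apply/eqP/negPn/negP => psiv.
have psiw : gelfand (scale_real cw 1 : C) psi = 1.
  by apply: (mulfI psiv); rewrite -gelfandM mul_scale_real1// mulr1.
suff : `|gelfand f psi| <= (2 * e)%:C.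
  by rewrite -dE lecR /e leNgt => /negP; apply; lra.
rewrite -[gelfand f psi]mul1r -psiw -gelfandM scale_real1M.
apply: (le_trans (gelfand_le_norm _ _)); apply: cfun_norm_le => [|x].
  by rewrite lecR mulr_ge0// ltW.
rewrite [leLHS]normrZ -Re_normE ger0_norm; last first.
  by rewrite lecR le_min ler01/= le_max lexx.
rewrite -rmorphM lecR; have w1 : w x <= 1 by rewrite ge_min lexx.
have f0' : 0 <= Re_norm (f x) by rewrite -lecR Re_normE normr_ge0.
have [fe|fe] := leP (2 * e) (Re_norm (f x)).
  rewrite [w x](_ : _ = 0) ?mul0r ?mulr_ge0 ?ltW//.
  rewrite /w (_ : Num.max _ _ = 0) ?min_r//; apply/max_idPl.
  by rewrite subr_le0 ler_pdivlMr.
by rewrite (le_trans _ (ltW fe))// ler_piMl.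
Qed.

Lemma character_cfunP psi :
  exists x, forall f, gelfand f psi = gelfand (cfun_cst cX (f x) : C) psi.
Proof.
(* The zero sets of the nonnegative functions killed by [psi] generate a
   proper filter, since a function without zeros is invertible; [x] is a
   cluster point of it. *)
pose F : set_system X := [set S | exists v (cv : continuous v),
  [/\ forall x, 0 <= v x, gelfand (scale_real cv 1 : C) psi = 0 &
      forall x, v x = 0 -> S x]].
have FF : ProperFilter F.
  apply: Build_ProperFilter_ex.
    move=> S [v [cv [v0 psiv vS]]]; apply: contrapT => S0.
    have vn0 x : v x != 0 by apply/eqP => /vS Sx; apply: S0; exists x.
    have cw : continuous (fun x => (v x)^-1).
      by move=> x; apply: cvgV => //; exact: cv.
    have : gelfand (scale_real cv 1 * scale_real cw 1 : C) psi = 1.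
      rewrite scale_real1M -[RHS](gelfand1 psi); congr (gelfand _ _).
      apply: cfunP => x; apply: etrans (scalerA _ _ _) _.
      by rewrite -rmorphM/= divff// scale1r.
    by rewrite gelfandM psiv mul0r => /eqP; rewrite eq_sym oner_eq0.
  split.
  - exists (fun=> 0), (@cst_continuous X R 0); split => //.
    rewrite -[RHS](gelfand0 psi); congr (gelfand _ _).
    by apply: cfunP => x; exact: scale0r.
  - move=> S T [v [cv [v0 psiv vS]]] [w [cw [w0 psiw wT]]].
    (* As [v] and [w] are nonnegative, the zero set of [v + w] is the intersection of theirs. *)
    have cvw : continuous (fun x => v x + w x).
      by move=> x; apply: cvgD; [exact: cv|exact: cw].
    exists _, cvw; split => [x||x].
    + by rewrite addr_ge0.
    + rewrite -[RHS]addr0 -{1}psiv -psiw -gelfandD; congr (gelfand _ _).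
      apply: cfunP => x; apply: etrans _ (scalerDl _ _ _).
      by congr (_ *: _); exact: rmorphD.
    + move=> /eqP; rewrite paddr_eq0// => /andP[/eqP/vS Sx /eqP/wT Tx].
      by split.
  - move=> S T ST [v [cv [v0 psiv vS]]]; exists v, cv; split => // x /vS.
    exact: ST.
have [x [_ clx]] := cX FF filterT.
(* Otherwise [psi] is nonzero at [h = f - f x], which vanishes at [x]. Then [psi] kills
   [max 0 (e - |h|)], so the zero set of this function belongs to [F]; but it misses the
   neighborhood [|h| < e] of [x]. *)
exists x => f; apply/eqP; rewrite -subr_eq0 -gelfandB; apply/negPn/negP => f0.
have [e e0 psi0] := gelfand_bump f0.
set h : C := f - _ in f0 psi0.
have ch := @Re_norm_cfun_continuous h.
have cv : continuous (fun y => Num.max 0 (e - Re_norm (h y))).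
  have cB : continuous (fun y => e - Re_norm (h y)).
    by move=> y; apply: cvgB; [exact: cvg_cst|exact: ch].
  exact: (max_fun_continuous (@cst_continuous X R 0) cB).
have FZ : F [set y | Num.max 0 (e - Re_norm (h y)) = 0].
  exists _, cv; split => [y||//]; first by rewrite le_max lexx.
  by apply: psi0 => y ey; apply/max_idPl; rewrite subr_le0.
have nU : nbhs x [set y | Re_norm (h y) < e].
  apply: (cvgr_lt _ (ch x)).
  have -> : h x = 0 by exact: subrr.
  by rewrite -ltcR Re_normE normr0 ltcR.
have [y [/= vy hy]] := clx _ _ FZ nU.
by move: vy; apply/eqP; rewrite gt_eqF// lt_max subr_gt0 hy orbT.
Qed.

Lemma cfun_eval_subproof x (phi : character_space E) :
  nonzero_characters C (fun f => gelfand (f x) phi).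
Proof.
split=> [k f g|f g|].
- exact: gelfand_linear.
- exact: gelfandM.
- by exists 1; rewrite [X in X != 0](gelfand1 phi) oner_eq0.
Qed.

Definition cfun_eval x (phi : character_space E) : character_space C :=
  SigSub (mem_set (cfun_eval_subproof x phi)).

Lemma gelfand_eval f x (phi : character_space E) :
  gelfand f (cfun_eval x phi) = gelfand (f x) phi.
Proof. by []. Qed.

Lemma cfun_restr_subproof psi :
  nonzero_characters E (fun a => gelfand (cfun_cst cX a : C) psi).
Proof.
split=> [k a b|a b|].
- rewrite -[RHS]gelfand_linear; congr (gelfand _ _); exact: cfunP.
- rewrite -[RHS]gelfandM; congr (gelfand _ _); exact: cfunP.
- by exists 1; rewrite [X in X != 0](gelfand1 psi) oner_eq0.
Qed.

Definition cfun_restr psi : character_space E :=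
  SigSub (mem_set (cfun_restr_subproof psi)).

Lemma cfun_evalK x : cancel (cfun_eval x) cfun_restr.
Proof. by move=> phi; apply: character_inj. Qed.

(** No continuous choice of [x] is made here: its nearness to a given point is later read off from
    the values of characters at real functions. *)
Lemma cfun_restrK psi : exists x, psi = cfun_eval x (cfun_restr psi).
Proof.
by have [x px] := character_cfunP psi; exists x; apply: character_inj.
Qed.

Lemma cfun_restr_continuous : continuous cfun_restr.
Proof.
by apply: character_space_continuous => a; exact: (@gelfand_continuous _ C).
Qed.

(** For joint continuity, split [phi (f x) - chi (f y)] into [(phi - chi) (f x)] and
    [chi (f x - f y)]; the second term is at most [|f x - f y|], uniformly in [chi], since
    characters are contractive. *)
Lemma cfun_eval_continuous :
  continuous (fun z : X * character_space E => cfun_eval z.1 z.2).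
Proof.
apply: character_space_continuous => f [x phi]; apply/cvgrPdist_lt => e e0 /=.
near=> z; rewrite !gelfand_eval.
rewrite -[gelfand _ phi](subrK (gelfand (f x) z.2)) -addrA -gelfandB.
rewrite (le_lt_trans (ler_normD _ _))// [ltRHS]splitr ltrD//.
  near: z; apply: cvgr_dist_lt; last by rewrite divr_gt0.
  apply: (@continuous_comp _ _ _ snd (gelfand (f x) : _ -> R[i]^o) (x, phi)).
    exact: cvg_snd.
  exact: gelfand_continuous.
rewrite (le_lt_trans (gelfand_le_norm _ _))//.
near: z; apply: cvgr_dist_lt; last by rewrite divr_gt0.
apply: (@continuous_comp _ _ _ fst f (x, phi)); first exact: cvg_fst.
exact: cfun_continuous.
Unshelve. all: by end_near. Qed.

End characters_of_cfun.

(** * Transfer of relative units between [E] and [C(X, E)] *)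

Lemma ideal_JP (R : realType) (A : comBanachAlgType R[i])
    (phi : character_space A) (a : A) :
  ideal_J phi a <-> \forall chi \near phi, gelfand a chi = 0.
Proof.
split=> [Ja|a0 cl]; last by have [chi [/eqP]] := cl _ a0.
apply: contrapT => na0; apply: Ja => B nB; apply: contrapT => B0.
apply: na0; apply: filterS nB => chi Bchi; apply: contrapT => /eqP a0.
by apply: B0; exists chi.
Qed.

(** Urysohn's lemma for the point [x0] and the complement of the interior of [U]; compact Hausdorff
    spaces are normal. *)
Lemma bump_function (R : realType) (X : topologicalType) (x0 : X) (U : set X) :
  compact [set: X] -> hausdorff_space X -> nbhs x0 U ->
  exists t : X -> R, [/\ continuous t, forall x, 0 <= t x <= 1,
    forall x, ~ U x -> t x = 0 & t x0 = 1].
Proof.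
move=> cX hX U0.
have nX : normal_space X by exact: compact_normal.
have cA : closed (~` U°) by apply: open_closedC; exact: open_interior.
have cB : closed [set x0] by apply: compact_closed => //; exact: compact_set1.
have AB0 : ~` U° `&` [set x0] = set0.
  by rewrite -subset0 => x [/= nUx xx0]; apply: nUx; rewrite xx0.
have /(@normal_separatorP R) /(_ _ _ cA cB AB0) := nX.
move=> /(@uniform_separatorP _ R)[t [ct t01 t0 t1]]; exists t; split => //.
- by move=> x; have /= := t01 (t x) (ex_intro2 _ _ x I erefl); rewrite in_itv.
- move=> x nUx; apply: t0; exists x => //= /interior_subset; exact: nUx.
- by apply: t1; exists x0.
Qed.

Lemma bounded_relative_units_of_cfun (R : realType) (X : topologicalType)
    (cX : compact [set: X]) (E : comBanachAlgType R[i]) (x0 : X) :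
  bounded_relative_units (cfun cX E : comBanachAlgType R[i]) ->
  bounded_relative_units E.
Proof.
move=> bru phi; have [m m0 bruK] := bru (cfun_eval cX x0 phi).
have ce : continuous (cfun_eval cX x0 : character_space E -> _).
  by apply: character_space_continuous => f; exact: gelfand_continuous.
exists m => // K cK Kphi; have [||f [Jf f1 fm]] := bruK (cfun_eval cX x0 @` K).
- by apply: continuous_compact => //; exact: continuous_subspaceT.
- by move=> _ [chi Kchi <-] /(can_inj (cfun_evalK cX x0)); exact: Kphi.
exists (f x0); split.
(* The transform of [f x0] is that of [f] composed with the continuous map [cfun_eval cX x0], so
   vanishing near the image of [phi] pulls back. *)
- by apply/ideal_JP; move/ideal_JP: Jf => /ce.
- move=> _ [chi Kchi <-]; apply: f1.
  by exists (cfun_eval cX x0 chi) => //; exists chi.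
- by apply: le_trans fm; exact: cfun_norm_ub.
Qed.

Lemma cfun_bounded_relative_units (R : realType) (X : topologicalType)
    (cX : compact [set: X]) (hX : hausdorff_space X)
    (E : comBanachAlgType R[i]) :
  bounded_relative_units E ->
  bounded_relative_units (cfun cX E : comBanachAlgType R[i]).
Proof.
move=> bru psi; have [x0 psiE] := cfun_restrK psi.
set phi := cfun_restr psi in psiE.
have [m m0 bruK] := bru phi.
exists (Re_norm (1 : E) + m).
  by rewrite ltr_wpDl// -lecR Re_normE normr_ge0.
move=> K cK Kpsi.
have oK : open (~` K).
  apply: closed_openC; apply: compact_closed cK.
  exact: character_space_hausdorff.
have [[U V] /= [nU nV] UVK] : nbhs (x0, phi)
    ((fun z => cfun_eval cX z.1 z.2) @^-1` (~` K)).
  apply: (@cfun_eval_continuous _ _ cX E (x0, phi)).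
  apply: open_nbhs_nbhs; split=> //.
  by rewrite -psiE => /Kpsi; exact.
(* Removing the interior of [V] from the projection of [K] leaves a compact set that misses
   [phi]. *)
have [||a [Ja a1 am]] := bruK (@cfun_restr R X cX E @` K `&` ~` V°).
- apply: compact_closedI; last by apply: open_closedC; exact: open_interior.
  apply: continuous_compact => //; apply: continuous_subspaceT.
  exact: cfun_restr_continuous.
- by move=> chi [_ nVchi] /= chiE; apply: nVchi; rewrite chiE.
have [t [ct t01 tU t1]] := @bump_function R X x0 U cX hX nU.
(* Doubling and truncating makes [s] equal to 1 wherever [t >= 1/2], not merely at [x0]. *)
pose s x := Num.min 1 (2 * t x).
have cs : continuous s.
  have c2 : continuous (fun x => 2 * t x).
    by move=> x; apply: cvgMl_tmp; exact: ct.
  exact: (min_fun_continuous (@cst_continuous X R 1) c2).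
pose C := cfun cX E : comBanachAlgType R[i].
(* In this form the transform of [f] is 0 where [s = 1] and [a] has transform 0, and it is 1 where
   [s = 0] or [a] has transform 1. *)
pose f : C := 1 - scale_real cs (cfun_cst cX (1 - a) : C).
have fE x (chi : character_space E) :
    gelfand f (cfun_eval cX x chi) = 1 - (s x)%:C * (1 - gelfand a chi).
  by rewrite gelfandB gelfand1 gelfand_eval gelfandZ gelfandB gelfand1.
exists f; split.
- apply/ideal_JP.
  have /cfun_restr_continuous a0 : \forall chi \near phi, gelfand a chi = 0.
    exact/ideal_JP.
  (* A character over the point [x] takes the value [t x] at [t 1]. Being close to [psi] thus forces
     [|1 - t x| < 1/2], hence [s x = 1]. *)
  have psit : gelfand (scale_real ct 1 : C) psi = 1.
    by rewrite psiE gelfand_eval gelfandZ t1 gelfand1 mulr1.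
  have tnear : \forall chi \near psi,
      `|gelfand (scale_real ct 1 : C) psi - gelfand (scale_real ct 1 : C) chi|
      < (2^-1)%:C.
    have /cvgrPdist_lt := @gelfand_continuous R C (scale_real ct 1) psi.
    by apply; rewrite ltcR invr_gt0.
  near=> chi.
  have [x chiE] := cfun_restrK chi.
  have chia : gelfand a (cfun_restr chi) = 0 by near: chi; exact: a0.
  have : `|1 - gelfand (scale_real ct 1 : C) chi| < (2^-1)%:C
    by rewrite -[X in X - _]psit; near: chi; exact: tnear.
  rewrite {1}chiE gelfand_eval gelfandZ gelfand1 mulr1 => tx.
  rewrite chiE fE chia subr0 mulr1 (_ : s x = 1) ?subrr//.
  apply/min_idPl.
  move: tx; rewrite -rmorphB/= normc_def/= expr0n addr0 sqrtr_sqr ltcR.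
  by rewrite ltr_norml => /andP[_]; lra.
- move=> _ [chi Kchi <-] /=; have [x chiE] := cfun_restrK chi.
  (* If [x] lies in [U], the restriction of [chi] is outside the interior of [V], because [U x V]
     misses [K], so [a] has transform 1 there; otherwise [s x = 0]. *)
  rewrite chiE fE; have [Ux|nUx] := pselect (U x).
    rewrite (a1 (gelfand a (cfun_restr chi))) ?subrr ?mulr0 ?subr0//.
    exists (cfun_restr chi) => //; split; first by exists chi.
    move=> /interior_subset Vchi; apply: (UVK (x, cfun_restr chi)) => //=.
    by rewrite -chiE.
  by rewrite /s tU// mulr0 min_r// mul0r subr0.
- rewrite rmorphD/= Re_normE; apply: cfun_norm_le => [|x].
    by rewrite addr_ge0// lecR ltW.
  (* The convex form gives a bound by [|1| + m], which does not depend on [K]. *)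
  have -> : f x = (1 - s x)%:C *: (1 : E) + (s x)%:C *: a.
    rewrite rmorphB/= scalerBl scale1r -addrA; congr (_ + _).
    by apply: etrans (congr1 -%R (scalerBr _ _ _)) _; rewrite opprB addrC.
  rewrite (le_trans (ler_normD _ _))// !normrZ.
  have s01 : 0 <= s x <= 1.
    by rewrite le_min ler01 ge_min lexx mulr_ge0//; case/andP: (t01 x).
  have [s0 s1] := andP s01.
  rewrite !ger0_norm ?lecR ?subr_ge0// lerD//.
    by rewrite ler_piMl// lecR gerBl.
  by rewrite (le_trans _ am)// ler_piMl// lecR.
Unshelve. all: by end_near. Qed.

Theorem corollary1p1 (R : realType) (X : topologicalType)
    (X0 : [set: X] !=set0) (cX : compact [set: X]) (hX : hausdorff_space X)
    (E : comBanachAlgType R[i]) :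
  bounded_relative_units (cfun cX E : comBanachAlgType R[i]) <->
  bounded_relative_units E.
Proof.
have [x0 _] := X0.
split; first exact: bounded_relative_units_of_cfun.
exact: cfun_bounded_relative_units.
Qed.
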